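(* Let $G$ be a Polish group and $X$ a Polish $G$-space. If $X$ is generically unbalanced, then the orbit equivalence relation $E^G_X$ is not classifiable by TSI-group actions.
   Context: A Polish group is TSI if it admits a compatible two-side invariant metric. A Polish $G$-space is a Polish space $X$ with a continuous left action of the Polish group $G$; $[x]=Gx$ denotes the orbit of $x$, and $x\,E^G_X\,y\iff [x]=[y]$. For $x,y\in X$ write $x\leftrightsquigarrow y$ if for every open neighborhood $V$ of the identity of $G$ and every open $U\subseteq X$ having nonempty intersection with the orbit of $x$ or with the orbit of $y$, there exist $g^x,g^y\in G$ with $g^xx\in U$ and $g^yy\in U$ such that $g^yy\in\overline{V(g^xx)}$ and $g^xx\in\overline{V(g^yy)}$. This is symmetric and invariant under the action in each variable, so one writes $[x]\leftrightsquigarrow[y]$ when $x\leftrightsquigarrow y$. For a $G$-invariant $C\subseteq X$, let $C/G=\{[x]: x\in C\}$. A path in $C/G$ from $[x]$ to $[y]$ is a sequence $x_0,\dots,x_{n-1}\in C$ with $x_0=x$, $x_{n-1}=y$ and $x_{i-1}\leftrightsquigarrow x_i$ for all $0<i<n$. $(X/G,\leftrightsquigarrow)$ is generically semi-connected if for every $G$-invariant comeager $C\subseteq X$ there is a comeager $D\subseteq C$ such that for all $x,y\in D$ there is a path between $[x]$ and $[y]$ in $(C/G,\leftrightsquigarrow)$. The Polish $G$-space $X$ is generically unbalanced if all its orbits are meager and $(X/G,\leftrightsquigarrow)$ is generically semi-connected. An equivalence relation $E$ on a Polish space $X$ is classifiable by TSI-group actions if there are a TSI Polish group $H$, a Polish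 $H$-space $Y$, and a Borel map $f:X\to Y$ with $x\,E\,x'\iff f(x)\,E^H_Y\,f(x')$ for all $x,x'\in X$. *)

(* Defs.v *)
From HB Require Import structures.
From mathcomp Require Import all_boot all_order all_algebra.
From mathcomp Require Import all_classical reals topology.
From mathcomp Require Import measurable_structure.

Set Implicit Arguments.
Unset Strict Implicit.
Unset Printing Implicit Defensive.

Import Order.TTheory GRing.Theory Num.Theory.

Local Open Scope classical_set_scope.

(* The library only has additive (abelian) topological groups; [groupType] is
   the structure of possibly infinite multiplicative groups. *)
#[short(type="preTopologicalGroupType")]
HB.structure Definition PreTopologicalGroup := {G of Group G & Topological G}.

HB.mixin Record PreTopologicalGroup_isTopologicalGroup G
    of PreTopologicalGroup G := {
  mulg_continuous : continuous (fun p : G * G => (p.1 * p.2)%g) ;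
  invg_continuous : continuous (fun x : G => x^-1%g)
}.

#[short(type="topologicalGroupType")]
HB.structure Definition TopologicalGroup :=
  {G of PreTopologicalGroup_isTopologicalGroup G & PreTopologicalGroup G}.

Section polish.
Context (R : realType).
Local Open Scope ring_scope.

Record compatible_metric (X : topologicalType) (d : X -> X -> R) : Prop := {
  cmetric_eq0 : forall x y, d x y = 0 <-> x = y ;
  cmetric_sym : forall x y, d x y = d y x ;
  cmetric_triangle : forall y x z, d x z <= d x y + d y z ;
  cmetric_nbhs : forall x (A : set X),
    nbhs x A <-> exists2 e, 0 < e & [set y | d x y < e] `<=` A
}.

Definition complete_metric (X : topologicalType) (d : X -> X -> R) : Prop :=
  forall u : nat -> X,
    (forall e, 0 < e -> exists N : nat, forall m n : nat,
       (N <= m)%N -> (N <= n)%N -> d (u m) (u n) < e) ->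
    exists l : X, u @ \oo --> l.

Definition separable_space (X : topologicalType) : Prop :=
  exists2 D : set X, countable D & dense D.

(* The empty space is Polish in this sense. *)
Definition polish (X : topologicalType) : Prop :=
  separable_space X /\
  exists2 d : X -> X -> R, compatible_metric d & complete_metric d.

(* The invariant metric is not required to be complete. *)
Definition tsi (G : topologicalGroupType) : Prop :=
  exists2 d : G -> G -> R, compatible_metric d &
    forall g h x y : G, d (g * x * h)%g (g * y * h)%g = d x y.

End polish.

Section category.
Context (X : topologicalType).

Definition nowhere_dense (A : set X) : Prop := interior (closure A) = set0.

Definition meager (A : set X) : Prop :=
  exists2 F : nat -> set X,
    (forall n, nowhere_dense (F n)) & A `<=` \bigcup_n F n.

Definition comeager (A : set X) : Prop := meager (~` A).

Definition borel_set (A : set X) : Prop := <<s [set U : set X | open U] >> A.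

End category.

Definition borel_map (X Y : topologicalType) (f : X -> Y) : Prop :=
  forall B : set Y, borel_set B -> borel_set (f @^-1` B).

Section gspace.

Record left_action (G : groupType) (X : Type) (act : G -> X -> X) : Prop := {
  left_act1 : forall x, act 1%g x = x ;
  left_actM : forall g h x, act (g * h)%g x = act g (act h x)
}.

Definition polish_gspace (R : realType) (G : topologicalGroupType)
    (X : topologicalType) (act : G -> X -> X) : Prop :=
  [/\ polish R X, left_action act & continuous (fun p : G * X => act p.1 p.2)].

Context (G : topologicalGroupType) (X : topologicalType) (act : G -> X -> X).

Definition gorbit (x : X) : set X := [set act g x | g in [set: G]].

Definition orbit_eqrel (x y : X) : Prop := gorbit x = gorbit y.

(* x <~> y *)
Definition unbalanced_rel (x y : X) : Prop :=
  forall (V : set G) (U : set X),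
    open V -> V 1%g -> open U ->
    (U `&` gorbit x) !=set0 \/ (U `&` gorbit y) !=set0 ->
    exists gx gy : G,
      [/\ U (act gx x), U (act gy y),
          closure [set act v (act gx x) | v in V] (act gy y) &
          closure [set act v (act gy y) | v in V] (act gx x)].

Definition ginvariant (C : set X) : Prop := forall g x, C x -> C (act g x).

(* The vertices of a path are given by representatives: [unbalanced_rel] only
   depends on orbits. The path is s 0, ..., s n. *)
Definition orbit_path (C : set X) (x y : X) : Prop :=
  exists (n : nat) (s : nat -> X),
    [/\ s 0%N = x, s n = y, forall i, (i <= n)%N -> C (s i) &
        forall i, (i < n)%N -> unbalanced_rel (s i) (s i.+1)].

Definition generically_semi_connected : Prop :=
  forall C : set X, ginvariant C -> comeager C ->
    exists D : set X, [/\ comeager D, D `<=` C &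
      forall x y, D x -> D y -> orbit_path C x y].

Definition generically_unbalanced : Prop :=
  (forall x, meager (gorbit x)) /\ generically_semi_connected.

End gspace.

Definition classifiable_by_tsi_actions (R : realType) (X : topologicalType)
    (E : X -> X -> Prop) : Prop :=
  exists (H : topologicalGroupType) (Y : topologicalType) (act : H -> Y -> Y)
    (f : X -> Y),
    [/\ polish R H, tsi R H, polish_gspace R act, borel_map f &
        forall x x', E x x' <-> orbit_eqrel act (f x) (f x')].

(* Main.v *)
Require Import Defs.
From mathcomp Require Import all_boot all_order all_algebra.
From mathcomp Require Import all_classical reals topology.
From mathcomp Require Import measurable_structure lra.

(** Let [f] be a Borel reduction of the orbit equivalence relation of [G] on [X]
    to that of a group [H] with two-sided invariant metric [d] acting on [Y].
    Orbits in [X] are meager, so it is enough to show that the preimage under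
    [f] of some [H]-orbit is not meager ([nonmeager_orbit_preimage]).

    Write |w| for [d 1 w] and fix a countable dense subgroup [S] of [H].  Take a
    countable family [BB] of Borel subsets of [Y] whose traces on the orbits of
    [H] are open.  [approx BB e y z] says that every [S]-translate of a set of
    [BB] that contains [z] meets [{w y : |w| < e}]: as seen by [BB], [z] is in the
    closure of that set.
    [asymptotic BB y z] says that, for each [e], some point of the orbit of [y]
    and [z] approximate each other up to [e].  By invariance of [d], lengths are
    conjugation invariant, so approximations can be translated along orbits
    and [asymptotic BB] is transitive.

    For every such [BB], on a comeager invariant set, unbalanced points have
    [asymptotic BB] images ([unbalanced_asymptotic]): outside a meager set the
    sets of [BB] pull back to open sets, and [f] is almost constant, up to |w|
    small, on pieces of orbits.  Generic semi-connectedness then puts [f x] in a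
    single class of [asymptotic BB] for generic [x].

    For a fixed [BB] this class is in general larger than an orbit, and shrinking
    it by enlarging [BB] may take a transfinite process.  The countable chain
    condition makes the process stop for generic pairs: there is a [BB0] such
    that no larger countable family changes [approx BB0] between translates of
    [f x] and [f x'], for a comeager set of pairs [(x, x')] ([stable_stage]).
    Let [BB1] be [BB0] with the sets of points that approximate some translate
    of [f x0] added, where [x0] is generic for [BB0].  Arbitrarily
    fine ones among them contain [f x'], so whenever [approx BB1] brings [h (f x)]
    within e of [f x'], some [w] with |w| < e takes [h (f x)] into a set all of
    whose points approximate [f x'] much better for [BB0], hence, by stability,
    for [BB1].  Iterating gives a [d]-Cauchy sequence in [H]; invariant metrics
    of Polish groups are complete ([tsi_complete]), and its limit takes [f x] to
    [f x'] ([approx_limit]). *)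

Set Implicit Arguments.
Unset Strict Implicit.
Unset Printing Implicit Defensive.

Import Order.TTheory GRing.Theory Num.Theory.

(** * Baire category and Borel sets *)

Section category_lemmas.
Local Open Scope classical_set_scope.

(** Options allow [D] to be empty. *)
Lemma countable_enum I (D : set I) : countable D ->
  exists e : nat -> option I, forall i, D i <-> exists n, e n = Some i.
Proof.
move=> /countable_injP[g ginj].
exists (fun n => if pselect (exists i, D i /\ g i = n) is left h
                 then Some (projT1 (cid h)) else None) => i; split=> [Di|[n]].
  exists (g i); case: pselect => [h|[]]; last by exists i.
  by case: (cid h) => j /= [Dj gj]; congr Some; apply: ginj; rewrite ?inE.
by case: pselect => // h [<-]; case: (cid h) => j [].
Qed.

Context {X : topologicalType}.
Implicit Types A B O : set X.

Lemma meager_sub A B : A `<=` B -> meager B -> meager A.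
Proof. by move=> AB [F nF BF]; exists F => //; apply: subset_trans BF. Qed.

Lemma meager_bigcup (F : nat -> set X) :
  (forall n, meager (F n)) -> meager (\bigcup_n F n).
Proof.
move=> mF; have /choice[H HP] : forall n, exists H : nat -> set X,
    (forall k, nowhere_dense (H k)) /\ F n `<=` \bigcup_k H k.
  by move=> n; have [H ? ?] := mF n; exists H.
exists (fun m => if unpickle m is Some nk then H nk.1 nk.2 else set0).
  move=> m; case: unpickle => [[n k]|]; first exact: (HP n).1.
  by rewrite /nowhere_dense closure0 interior0.
move=> x [n _ /(HP n).2[k _ Hx]]; exists (pickle (n, k)) => //.
by rewrite pickleK.
Qed.

Lemma comeager_sub A B : A `<=` B -> comeager A -> comeager B.
Proof. by move=> AB; apply: meager_sub; exact: subsetC. Qed.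

Lemma meager0 : meager (@set0 X).
Proof.
by exists (fun=> set0) => // n; rewrite /nowhere_dense closure0 interior0.
Qed.

Lemma comeagerT : comeager [set: X].
Proof. by rewrite /comeager setCT; exact: meager0. Qed.

Lemma comeager_bigcap (F : nat -> set X) :
  (forall n, comeager (F n)) -> comeager (\bigcap_n F n).
Proof. by move=> cF; rewrite /comeager setC_bigcap; exact: meager_bigcup. Qed.

Lemma comeager_forall I (D : set I) (P : I -> X -> Prop) : countable D ->
  (forall i, D i -> comeager [set x | P i x]) ->
  comeager [set x | forall i, D i -> P i x].
Proof.
move=> /countable_enum[e eP] cP.
have : comeager (\bigcap_n (if e n is Some i then [set x | P i x] else setT)).
  apply: comeager_bigcap => n; case en : (e n) => [i|]; last exact: comeagerT.
  by apply: cP; apply/eP; exists n.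
by apply: comeager_sub => x Fx i /eP[n en]; have := Fx n Logic.I; rewrite en.
Qed.

Lemma comeagerI A B : comeager A -> comeager B -> comeager (A `&` B).
Proof.
move=> cA cB; have : comeager (\bigcap_n (if n is 0 then A else B)).
  by apply: comeager_bigcap => -[].
by apply: comeager_sub => x ABx; split; [exact: (ABx 0%N)|exact: (ABx 1%N)].
Qed.

Lemma nowhere_dense_setC O : open O -> dense O -> nowhere_dense (~` O).
Proof.
move=> oO dO; rewrite /nowhere_dense -(closure_id _).1; last exact: open_closedC.
rewrite -subset0 => x ix.
have [y []] := dO (~` O)° (ex_intro _ x ix) (open_interior _).
by move=> /interior_subset.
Qed.

Lemma comeager_open_dense O : open O -> dense O -> comeager O.
Proof.
by move=> oO dO; exists (fun=> ~` O) => [_|x Ox];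
  [exact: nowhere_dense_setC|exists 0%N].
Qed.

Lemma nowhere_dense_dense A : nowhere_dense A -> dense (~` closure A).
Proof.
move=> nA O [x Ox] oO; apply: contrapT => /set0P/negP/negPn/eqP OA.
have : (closure A)° x.
  rewrite /interior/= nbhsE; exists O => // y Oy; apply: contrapT => nAy.
  by have : (O `&` ~` closure A) y by []; rewrite OA.
by rewrite nA.
Qed.

Definition baire_space := forall A, comeager A -> dense A.

Lemma baire_point A O x : baire_space -> comeager A -> open O -> O x ->
  exists2 y, O y & A y.
Proof.
by move=> bX cA oO Ox; have [|y []] := bX _ cA O _ oO; [exists x|exists y].
Qed.

Definition baire_property A :=
  exists2 O, open O & comeager [set x | A x <-> O x].

(** If [A] agrees with an open [O] up to a meager set, then its complement agrees
    with the exterior of [O], as the boundary of [O] is nowhere dense. *)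
Lemma baire_property_setC A : baire_property A -> baire_property (~` A).
Proof.
move=> [O oO cO]; exists (~` closure O).
  exact/closed_openC/closed_closure.
have : comeager (O `|` ~` closure O).
  apply: comeager_open_dense.
    by apply: openU => //; exact/closed_openC/closed_closure.
  move=> V [x Vx] oV; have [[y [Oy Vy]]|nV] := pselect (O `&` V !=set0).
    by exists y; split=> //; left.
  exists x; split => //; right => /(_ V); case; first exact: open_nbhs_nbhs.
  by move=> y [Oy Vy]; apply: nV; exists y.
move=> /(comeagerI cO); apply: comeager_sub => x /= [AO OC]; split.
  by move=> Ax; case: OC => // /AO.
by move=> nOx /AO Ox; apply: nOx; exact: subset_closure.
Qed.

Lemma borel_baire_property A : borel_set A -> baire_property A.
Proof.
move: A; apply: smallest_sub => [|O oO]; last first.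
  by exists O => //; apply: comeager_sub comeagerT => x _.
split.
- exists set0; first exact: open0.
  by apply: comeager_sub comeagerT => x _.
- by move=> B BB; rewrite setTD; exact: baire_property_setC.
- move=> F BF; have /choice[O OP] : forall n, exists O,
    open O /\ comeager [set x | F n x <-> O x].
    by move=> n; have [O] := BF n; exists O.
  exists (\bigcup_n O n); first by apply: bigcup_open => n _; exact: (OP n).1.
  have : comeager (\bigcap_n [set x | F n x <-> O n x]).
    by apply: comeager_bigcap => n; exact: (OP n).2.
  by apply: comeager_sub => x FO; split=> -[n _ nx]; exists n => //; exact/FO.
Qed.

Lemma borel_open O : open O -> borel_set O.
Proof. by move=> oO; exact: sub_sigma_algebra. Qed.

Lemma borel_setC A : borel_set A -> borel_set (~` A).
Proof.
have [_ sC _] := smallest_sigma_algebra setT [set U : set X | open U].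
by rewrite -setTD; exact: sC.
Qed.

Lemma borel0 : borel_set (@set0 X).
Proof. by apply: borel_open; exact: open0. Qed.

Lemma borel_exists I (D : set I) (P : I -> X -> Prop) : countable D ->
  (forall i, D i -> borel_set [set x | P i x]) ->
  borel_set [set x | exists2 i, D i & P i x].
Proof.
move=> /countable_enum[e eP] bP.
have [_ _ bU] := smallest_sigma_algebra setT [set U : set X | open U].
rewrite (_ : [set x | _] =
    \bigcup_n (if e n is Some i then [set x | P i x] else set0)).
  apply: bU => n; case en : (e n) => [i|]; last exact: borel0.
  by apply: bP; apply/eP; exists n.
apply/seteqP; split=> [x [i /eP[n en] Pi]|x [n _]].
  by exists n => //; rewrite en.
by case en : (e n) => [i|]// Pi; exists i => //; apply/eP; exists n.
Qed.

Lemma borel_forall I (D : set I) (P : I -> X -> Prop) : countable D ->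
  (forall i, D i -> borel_set [set x | P i x]) ->
  borel_set [set x | forall i, D i -> P i x].
Proof.
move=> cD bP; rewrite (_ : [set x | _] =
  ~` [set x | exists2 i, D i & ~ P i x]).
  by apply: borel_setC; apply: borel_exists => // i /bP/borel_setC.
apply/seteqP; split=> [x Px [i /Px]//|x nx i Di].
by apply: contrapT => nP; apply: nx; exists i.
Qed.

Lemma borel_setU A B : borel_set A -> borel_set B -> borel_set (A `|` B).
Proof.
move=> bA bB; rewrite (_ : A `|` B = [set x | exists2 b : bool,
  [set: bool] b & (if b then A else B) x]).
  by apply: borel_exists => // -[].
by apply/seteqP; split=> [x [?|?]|x [[] _ ?]];
  [exists true|exists false|left|right].
Qed.

Lemma borel_imply A B : borel_set A -> borel_set B ->
  borel_set [set x | A x -> B x].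
Proof.
move=> bA bB; rewrite (_ : [set x | _] = ~` A `|` B).
  by apply: borel_setU => //; exact: borel_setC.
apply/seteqP; split=> x /= => [AB|[nAx /nAx|]//].
by have [/AB|] := pselect (A x); [right|left].
Qed.

Lemma borel_setI A B : borel_set A -> borel_set B -> borel_set (A `&` B).
Proof.
move=> bA bB; rewrite (_ : A `&` B = ~` (~` A `|` ~` B)).
  by apply: borel_setC; apply: borel_setU; exact: borel_setC.
by rewrite setCU !setCK.
Qed.

End category_lemmas.
Arguments baire_space X : clear implicits.

Section borel_maps.
Local Open Scope classical_set_scope.

Lemma continuous_borel_map (X Y : topologicalType) (f : X -> Y) :
  continuous f -> borel_map f.
Proof.
move=> cf; apply: (@smallest_sub _ _ _ [set B | borel_set (f @^-1` B)]).
  split => /=.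
  - by rewrite preimage_set0; exact: borel0.
  - by move=> B bB; rewrite setTD preimage_setC; exact: borel_setC.
  - move=> F bF; rewrite preimage_bigcup.
    have [_ _] := smallest_sigma_algebra setT [set U : set X | open U].
    exact.
by move=> O oO; apply: borel_open; move/continuousP : cf; apply.
Qed.

Lemma borel_map_comp (X Y Z : topologicalType) (g : Y -> Z) (f : X -> Y) :
  borel_map f -> borel_map g -> borel_map (g \o f).
Proof. by move=> bf bg B bB; exact: (bf _ (bg _ bB)). Qed.

End borel_maps.

Section comeager_preimage.
Local Open Scope classical_set_scope.

(** Density of preimages replaces openness of [f]: it is the part of openness that
    pulling back category uses. *)
Lemma comeager_preimage (X Y : topologicalType) (f : X -> Y) (A : set Y) :
  continuous f -> (forall O, open O -> dense O -> dense (f @^-1` O)) ->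
  comeager A -> comeager (f @^-1` A).
Proof.
move=> cf df [F nF AF].
exists (fun n => ~` (f @^-1` (~` closure (F n)))).
  move=> n; have oF : open (~` closure (F n)).
    exact/closed_openC/closed_closure.
  apply: nowhere_dense_setC; first by move/continuousP: cf; apply.
  by apply: df => //; exact: nowhere_dense_dense.
move=> x /AF[n _ Fx]; exists n => //; apply; exact: subset_closure.
Qed.

End comeager_preimage.

Section kuratowski_ulam.
Local Open Scope classical_set_scope.
Context {X Z : topologicalType}.
Hypothesis scZ : @second_countable Z.

Lemma prod_nbhsP (x : X) (z : Z) (A : set (X * Z)) : nbhs (x, z) A ->
  exists P Q, [/\ open P, P x, open Q, Q z & P `*` Q `<=` A].
Proof.
move=> [[P Q] /= [nP nQ] PQA]; exists P°, Q°.
split; [exact: open_interior|exact: nP|exact: open_interior|exact: nQ|].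
by move=> [a b] [/= /interior_subset Pa /interior_subset Qb]; exact: PQA.
Qed.

Lemma second_countable_prod : @second_countable X ->
  @second_countable (X * Z)%type.
Proof.
move=> [B cB [oB bB]]; have [C cC [oC bC]] := scZ.
exists ((fun PQ => PQ.1 `*` PQ.2) @` (B `*` C)).
  by apply: (card_le_trans (card_image_le _ _)); exact: countableX.
split=> [_ [[P Q] [/= BP CQ] <-]|[x z] A /prod_nbhsP[P [Q [oP Px oQ Qz PQA]]]].
  rewrite openE => -[x z] [/= Px Qz]; exists (P, Q) => //=.
  by split; apply: open_nbhs_nbhs; split=> //; [exact: oB|exact: oC].
have [P' [BP' Px'] PP'] := bB x P (open_nbhs_nbhs (conj oP Px)).
have [Q' [CQ' Qz'] QQ'] := bC z Q (open_nbhs_nbhs (conj oQ Qz)).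
exists (P' `*` Q'); first by split=> //; exists (P', Q').
by move=> [a b] [/= /PP' Pa /QQ' Qb]; apply: PQA.
Qed.

(** An open dense set has a dense section over every [x] whose section meets all
    nonempty basic open sets of [Z]; each of these countably many conditions
    holds for an open dense set of [x]. *)
Lemma kuratowski_ulam (A : set (X * Z)) : comeager A ->
  comeager [set x | comeager [set z | A (x, z)]].
Proof.
move=> [F nF AF]; have [B cB [oB bB]] := scZ.
have cG n V : B V -> V !=set0 ->
    comeager [set x | exists2 z, V z & ~ closure (F n) (x, z)].
  move=> BV V0; apply: comeager_open_dense.
    rewrite openE => x [z Vz nFz].
    have /prod_nbhsP[P [Q [oP Px oQ Qz PQ]]] :
        nbhs (x, z) (~` closure (F n)).
      by apply: open_nbhs_nbhs; split=> //; exact/closed_openC/closed_closure.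
    rewrite /interior/= nbhsE; exists P => // y Py; exists z => //.
    by apply: (PQ (y, z)).
  move=> O [x Ox] oO; have [z Vz] := V0.
  have [||[y v] [[/= Oy Vv] ny]] := nowhere_dense_dense (nF n) (O := O `*` V).
  - by exists (x, z).
  - rewrite openE => -[a b] [/= Oa Vb]; exists (O, V) => //=.
    by split; apply: open_nbhs_nbhs; split=> //; exact: oB.
  - by exists y; split=> //; exists v.
have : comeager [set x | forall n, [set: nat] n -> forall V, B V ->
    V !=set0 -> exists2 z, V z & ~ closure (F n) (x, z)].
  apply: comeager_forall => // n _; apply: comeager_forall => // V BV.
  have [V0|V0] := pselect (V !=set0).
    by apply: comeager_sub (cG n V BV V0) => x ? _.
  by apply: comeager_sub comeagerT => x _ /V0.
apply: comeager_sub => x xP /=; exists (fun n => [set z | F n (x, z)]).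
  move=> n; rewrite /nowhere_dense -subset0 => z iz.
  have [V [BV Vz] VF] : filter_from [set U | B U /\ U z] id
      (closure [set z | F n (x, z)])° .
    by apply: bB; exact: nbhs_interior.
  have [v Vv] := xP n I V BV (ex_intro _ z Vz); apply.
  move=> N /prod_nbhsP[P [Q [oP Px oQ Qv PQ]]].
  have [w [Fw Qw]] := interior_subset (VF v Vv) Q (open_nbhs_nbhs (conj oQ Qv)).
  by exists (x, w); split=> //; apply: PQ.
by move=> z /= /AF[n _ ?]; exists n.
Qed.

Lemma baire_prod : baire_space X -> baire_space Z -> baire_space (X * Z)%type.
Proof.
move=> bX bZ A /kuratowski_ulam cA O [[x z] Oxz] oO.
have /prod_nbhsP[P [Q [oP Px oQ Qz PQ]]] : nbhs (x, z) O.
  exact: open_nbhs_nbhs.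
have [x' Px' cx'] := baire_point bX cA oP Px.
have [z' Qz' Az'] := baire_point bZ cx' oQ Qz.
by exists (x', z'); split=> //; apply: PQ.
Qed.

End kuratowski_ulam.

(** * Compatible metrics and the Baire category theorem *)

Section halving.
Local Open Scope ring_scope.
Context {R : realType}.

Definition eps (n : nat) : R := 2^-1 ^+ n.

Lemma eps_gt0 n : 0 < eps n.
Proof. by rewrite exprn_gt0// invr_gt0. Qed.

Lemma epsS n : eps n = eps n.+1 + eps n.+1.
Proof. by rewrite /eps exprS; lra. Qed.

Lemma eps_le m n : (m <= n)%N -> eps n <= eps m.
Proof.
move=> /subnK <-; elim: (n - m)%N => [|k]; first by rewrite add0n.
by apply: le_trans; rewrite addSn (epsS (k + m)); have := eps_gt0 (k + m).+1; lra.
Qed.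

Lemma eps_lt (e : R) : 0 < e -> exists n, eps n < e.
Proof.
move=> e0; exists (Num.truncn e^-1).+1.
rewrite /eps exprVn invf_plt ?posrE ?exprn_gt0//.
apply: (lt_le_trans (truncnS_gt _)); rewrite -natrX ler_nat.
exact/ltnW/ltn_expl.
Qed.

End halving.

Section metric_lemmas.
Local Open Scope classical_set_scope.
Local Open Scope ring_scope.
Context {R : realType} {X : topologicalType} (d : X -> X -> R).
Hypothesis cd : compatible_metric d.

Lemma metricxx x : d x x = 0.
Proof. exact/(cmetric_eq0 cd). Qed.

Lemma metric_ge0 x y : 0 <= d x y.
Proof.
have := cmetric_triangle cd y x x.
by rewrite metricxx (cmetric_sym cd y); lra.
Qed.

Lemma metric_nbhs x e : 0 < e -> nbhs x [set y | d x y < e].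
Proof. by move=> e0; apply/(cmetric_nbhs cd); exists e. Qed.

Lemma metric_open x e : open [set y | d x y < e].
Proof.
rewrite openE => y /= dxy; apply/(cmetric_nbhs cd).
exists (e - d x y) => [|z /= dyz]; first by rewrite subr_gt0.
by have := cmetric_triangle cd y x z; lra.
Qed.

Lemma metric_openP (O : set X) x : open O -> O x ->
  exists2 e, 0 < e & [set y | d x y < e] `<=` O.
Proof. by move=> oO Ox; apply/(cmetric_nbhs cd); exact: open_nbhs_nbhs. Qed.

Lemma metric_cvgP (u : nat -> X) l : u @ \oo --> l <->
  forall e, 0 < e -> exists N, forall n, (N <= n)%N -> d l (u n) < e.
Proof.
split=> [ul e e0|ul A /(cmetric_nbhs cd)[e e0 eA]].
  by have [N _ NP] := ul _ (metric_nbhs l e0); exists N.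
by have [N NP] := ul e e0; exists N => // n /= /NP; exact: eA.
Qed.

Lemma metric_second_countable : separable_space X -> @second_countable X.
Proof.
move=> [D cD dD]; pose ball (p : X * nat) := [set y | d p.1 y < eps p.2].
exists (ball @` (D `*` setT)).
  by apply: (card_le_trans (card_image_le _ _)); exact: countableX.
split=> [_ [[a n] _ <-]|x A /(cmetric_nbhs cd)[e e0 eA]].
  exact: metric_open.
have [n en] := eps_lt e0.
have [||a [/= dxa Da]] := dD [set y | d x y < eps n.+1].
- by exists x; rewrite /= metricxx eps_gt0.
- exact: metric_open.
exists (ball (a, n.+1)); first split.
- by exists (a, n.+1).
- by rewrite /ball/= (cmetric_sym cd).
move=> z; rewrite /ball/= => daz; apply: eA => /=.
have := cmetric_triangle cd a x z; have := epsS (R := R) n; lra.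
Qed.

(** Nested balls: the closed ball of each step lies in the previous open ball and
    avoids one more nowhere dense set. *)
Lemma complete_baire : complete_metric d -> baire_space X.
Proof.
move=> cmd A [F nF AF] O [x0 Ox0] oO.
pose inball (q : nat * (X * R)) := [set y | d q.2.1 y <= q.2.2].
pose next q q' := [/\ q'.1 = q.1.+1, 0 < q'.2.2 < eps q.1 &
  inball q' `<=` [set y | d q.2.1 y < q.2.2 /\ ~ closure (F q.1) y]].
(* The radius is halved so that the closed ball is inside the open set found,
   and kept below [eps n] so that the centers form a Cauchy sequence. *)
have nextP (q : {q : nat * (X * R) | 0 < q.2.2}) :
    {q' : {q : nat * (X * R) | 0 < q.2.2} | next (val q) (val q')}.
  move: q => [[n [x r]] /= r0]; apply: cid.
  have [||y [/= xy nFy]] := nowhere_dense_dense (nF n) (O := [set y | d x y < r]).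
  - by exists x; rewrite /= metricxx.
  - exact: metric_open.
  have [||e e0 eP] := @metric_openP ([set y | d x y < r] `&` ~` closure (F n)) y.
  - apply: openI; first exact: metric_open.
    exact/closed_openC/closed_closure.
  - by [].
  pose s := Num.min e (eps n) / 2.
  have [s0 se sn] : [/\ 0 < s, s < e & s < eps n].
    have := eps_gt0 (R := R) n; rewrite /s; case: (leP e (eps n)) => ? ?.
      by split; lra.
    by split; lra.
  exists (exist _ (n.+1, (y, s)) s0); split=> //=; first by rewrite s0.
  by move=> z; rewrite /inball/= => yz; apply: eP => /=; lra.
have [e0 e0_gt0 e0O] := metric_openP oO Ox0.
have [q [q0 qS]] := dependent_choice nextP
  (exist (fun q : nat * (X * R) => 0 < q.2.2) (0%N, (x0, e0)) e0_gt0).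
have qn n : (val (q n)).1 = n.
  by elim: n => [|n IH]; [rewrite q0|have [-> _ _] := qS n; rewrite IH].
pose x n := (val (q n)).2.1; pose r n := (val (q n)).2.2.
have r_gt0 n : 0 < r n by exact: (valP (q n)).
have xr n m : (n <= m)%N -> d (x n) (x m) <= r n /\
   forall y, d (x m) y <= r m -> d (x n) y <= r n.
  move=> /subnK <-; elim: (m - n)%N => [|k [_ IH]].
    by rewrite add0n metricxx; split => //; exact: ltW.
  have IHS y : d (x (k.+1 + n)%N) y <= r (k.+1 + n)%N -> d (x n) y <= r n.
    move=> h; apply: IH; have [_ _ /(_ y h)[/ltW]] := qS (k + n)%N.
    by [].
  by split => //; apply: IHS; rewrite metricxx; exact: ltW.
have [l xl] : exists l : X, x @ \oo --> l.
  apply: cmd => e ee; have [N Ne] := eps_lt ee; exists N.+2 => m n Nm Nn.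
  have [_ /andP[_ rN] _] := qS N.+1.
  rewrite qn in rN; rewrite -/(r N.+2) in rN.
  have [dm _] := xr _ _ Nm; have [dn _] := xr _ _ Nn.
  have := cmetric_triangle cd (x N.+2) (x m) (x n).
  rewrite (cmetric_sym cd (x m) (x N.+2)); have := epsS (R := R) N; lra.
have lr n : d (x n) l <= r n.
  rewrite leNgt; apply/negP => rl.
  have gap : 0 < d (x n) l - r n by rewrite subr_gt0.
  have [N NP] := (metric_cvgP _ _).1 xl _ gap.
  have := NP (maxn N n) (leq_maxl _ _).
  have [dn _] := xr n (maxn N n) (leq_maxr _ _).
  have := cmetric_triangle cd (x (maxn N n)) (x n) l.
  by rewrite (cmetric_sym cd (x (maxn N n)) l); lra.
have lP n : d (x n) l < r n /\ ~ closure (F n) l.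
  have [_ _ /(_ l)] := qS n; rewrite qn; apply.
  exact: lr.
exists l; split.
  by apply: e0O => /=; have [+ _] := lP 0%N; rewrite /x /r q0.
apply: contrapT => /AF[n _ Fl]; have [_] := lP n; apply.
exact: subset_closure.
Qed.

End metric_lemmas.

Section polish_lemmas.
Context {R : realType} {X : topologicalType} (pX : polish R X).

Lemma polish_baire : baire_space X.
Proof. by have [_ [d cd cmd]] := pX; exact: (complete_baire cd cmd). Qed.

Lemma polish_second_countable : @second_countable X.
Proof. by have [sX [d cd _]] := pX; exact: (metric_second_countable cd sX). Qed.

End polish_lemmas.

(** * Groups with a two-sided invariant metric *)

Section tsi_lemmas.
Local Open Scope classical_set_scope.
Local Open Scope ring_scope.
Context {R : realType} {G : topologicalGroupType} (d : G -> G -> R).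
Hypotheses (cd : compatible_metric d)
  (dinv : forall g h x y : G, d (g * x * h)%g (g * y * h)%g = d x y).

Lemma tsi_mulgl g x y : d (g * x)%g (g * y)%g = d x y.
Proof. by have := dinv g 1%g x y; rewrite !mulg1. Qed.

Lemma tsi_mulgr g x y : d (x * g)%g (y * g)%g = d x y.
Proof. by have := dinv 1%g g x y; rewrite !mul1g. Qed.

Lemma tsi_lenM g h : d 1%g (g * h)%g <= d 1%g g + d 1%g h.
Proof.
apply: le_trans (cmetric_triangle cd g _ _) _.
by rewrite lerD2l -{1}(mulg1 g) tsi_mulgl.
Qed.

Lemma tsi_lenJ g h : d 1%g (g * h * g^-1)%g = d 1%g h.
Proof. by rewrite -(dinv g g^-1%g 1%g h) mulg1 mulgV. Qed.

Lemma tsi_len_div g h : d 1%g (g * h^-1)%g = d h g.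
Proof. by rewrite -(tsi_mulgr h) mul1g mulgVK. Qed.

(** A [d]-Cauchy sequence [u] need not be Cauchy for the complete metric [d'], but
    [u n * k] is, for generic [k].  Indeed near any [k0] one finds
    [k = (u M)^-1 * c] with [c] close to [u M * k0]: all later [u n * k] stay
    [d]-close to the prescribed point [c], where [d]-small implies [d']-small.
    The limit of [u n * k], translated by [k^-1], is the limit of [u]. *)
Lemma tsi_complete : polish R G -> complete_metric d.
Proof.
move=> pG; have [_ [d' cd' cmd']] := pG => u uC.
pose Om j := [set k | exists c r N s, [/\ 0 < r,
  (forall a b, d c a < r -> d c b < r -> d' a b < eps j), s < r &
  (forall n, (N <= n)%N -> d c (u n * k)%g <= s)]].
have oOm j : open (Om j).
  rewrite openE => k [c [r [N [s [r0 cr sr ks]]]]].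
  apply/(cmetric_nbhs cd); exists ((r - s) / 2) => [|k' /= kk']; first lra.
  exists c, r, N, (s + (r - s) / 2); split=> // [|n /ks cn]; first lra.
  apply: le_trans (cmetric_triangle cd (u n * k)%g _ _) _.
  by rewrite tsi_mulgl; lra.
have dOm j : dense (Om j).
  move=> O [k0 Ok0] oO; have [e e0 eO] := metric_openP cd oO Ok0.
  have [N NP] := uC e e0; pose c := (u N * k0)%g.
  have [|r r0 rP] := metric_openP cd (metric_open cd' c (eps j.+1)) (x := c).
    by rewrite /= (metricxx cd') eps_gt0.
  have [N' N'P] := uC (r / 2) (divr_gt0 r0 (ltr0n _ 2)).
  pose M := maxn N N'; exists ((u M)^-1 * c)%g; split.
    apply: eO => /=; rewrite -(tsi_mulgl (u M)) mulVKg /c tsi_mulgr.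
    exact: NP (leq_maxl _ _) (leqnn _).
  exists c, r, M, (r / 2); split=> // [a b ca cb||n Mn]; [|lra|].
    have /= := rP a ca; have /= := rP b cb.
    have := cmetric_triangle cd' c a b; rewrite (cmetric_sym cd' a c).
    by rewrite (epsS j); lra.
  rewrite -{1}(mulVKg (u M) c) tsi_mulgr; apply/ltW/N'P.
    exact: leq_maxr.
  exact: leq_trans (leq_maxr _ _) Mn.
have [k _ kOm] : exists2 k : G, [set: G] k & (\bigcap_j Om j) k.
  apply: (@baire_point _ _ _ 1%g); last by [].
  - exact: polish_baire pG.
  - by apply: comeager_bigcap => j; exact: comeager_open_dense.
  - exact: openT.
have [l kl] : exists l : G, (fun n => u n * k)%g @ \oo --> l.
  apply: cmd' => e /eps_lt[j je].
  have [c [r [N [s [r0 cr sr ks]]]]] := kOm j Logic.I.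
  exists N => m n Nm Nn; apply: lt_trans je.
  by apply: cr; [have := ks m Nm|have := ks n Nn]; lra.
exists (l * k^-1)%g; apply/(metric_cvgP cd) => e e0.
have [N NP] := (metric_cvgP cd _ _).1 kl e e0.
by exists N => n /NP; rewrite -(tsi_mulgr k (l * k^-1)%g) mulgVK.
Qed.

End tsi_lemmas.

Section group_lemmas.
Local Open Scope classical_set_scope.
Context {G : topologicalGroupType}.
Local Open Scope group_scope.

Lemma continuous_mulgl (g : G) : continuous (fun x : G => g * x).
Proof.
move=> x; apply: (@continuous_comp _ _ _ (fun x => (g, x)) (fun p => p.1 * p.2)).
  by apply: cvg_pair => //=; exact: cvg_cst.
exact: mulg_continuous.
Qed.

Lemma continuous_mulgr (g : G) : continuous (fun x : G => x * g).
Proof.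
move=> x; apply: (@continuous_comp _ _ _ (fun x => (x, g)) (fun p => p.1 * p.2)).
  by apply: cvg_pair => //=; exact: cvg_cst.
exact: mulg_continuous.
Qed.

(** Values of the words in a dense sequence and its inverses. *)
Lemma countable_dense_subgroup : separable_space G -> exists S : set G,
  [/\ countable S, dense S, S 1, (forall g h, S g -> S h -> S (g * h)) &
      forall g, S g -> S g^-1].
Proof.
move=> [D /countable_enum[e eP] dD].
pose letter (p : bool * nat) : G :=
  if e p.2 is Some a then (if p.1 then a^-1 else a) else 1.
pose word (s : seq (bool * nat)) := foldr (fun p g => letter p * g) 1 s.
have wordM s t : word (s ++ t) = word s * word t.
  by elim: s => [|p s /= ->]; rewrite ?mul1g ?mulgA.
exists (range word); split.
- by apply: (card_le_trans (card_image_le _ _)); exact: countableP.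
- move=> O O0 /(dD O O0)[a [Oa /eP[n en]]]; exists a; split=> //.
  by exists [:: (false, n)] => //=; rewrite /letter/= en mulg1.
- by exists [::].
- by move=> _ _ [s _ <-] [t _ <-]; exists (s ++ t).
- move=> _ [s _ <-]; exists (rev [seq (~~ p.1, p.2) | p <- s]) => //.
  elim: s => [|p s IH]; first by rewrite /= invg1.
  rewrite /= rev_cons -cats1 wordM IH /= mulg1 invgM; congr (_ * _).
  by case: p => -[] n; rewrite /letter/=; case: (e n) => [a|];
    rewrite ?invgK ?invg1.
Qed.

Lemma comeager_mulgr (A : set G) (g : G) :
  comeager A -> comeager [set x | A (x * g)].
Proof.
apply: comeager_preimage; first exact: continuous_mulgr.
move=> U oU dU O [x Ox] oO.
have [||y [/= Oy Uy]] := dU [set y | O (y * g^-1)].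
- by exists (x * g); rewrite /= mulgK.
- by move/continuousP: (@continuous_mulgr g^-1); apply.
- by exists (y * g^-1); split; rewrite //= mulgVK.
Qed.

End group_lemmas.

(** * Approximation along an orbit *)

Section action_lemmas.
Local Open Scope classical_set_scope.
Context {G : topologicalGroupType} {X : topologicalType} {act : G -> X -> X}.
Hypotheses (lact : left_action act)
  (cact : continuous (fun p : G * X => act p.1 p.2)).

Lemma continuous_act g : continuous (act g).
Proof.
move=> x; apply: (@continuous_comp _ _ _ (fun x => (g, x))
  (fun p : G * X => act p.1 p.2)); last exact: cact.
by apply: cvg_pair => //=; exact: cvg_cst.
Qed.

Lemma continuous_orbit x : continuous (act^~ x).
Proof.
move=> g; apply: (@continuous_comp _ _ _ (fun g => (g, x))
  (fun p : G * X => act p.1 p.2)); last exact: cact.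
by apply: cvg_pair => //=; exact: cvg_cst.
Qed.

Lemma actK g : cancel (act g) (act g^-1%g).
Proof. by move=> x; rewrite -(left_actM lact) mulVg (left_act1 lact). Qed.

Lemma actKV g : cancel (act g^-1%g) (act g).
Proof. by move=> x; rewrite -(left_actM lact) mulgV (left_act1 lact). Qed.

Lemma orbit_eqrelP x y : orbit_eqrel act x y <-> exists g, y = act g x.
Proof.
split=> [xy|[g ->]].
  have : gorbit act y y by exists 1%g => //; exact: (left_act1 lact).
  by rewrite -xy => -[g _ <-]; exists g.
apply/seteqP; split=> [_ [h _ <-]|_ [h _ <-]].
  by exists (h * g^-1)%g => //; rewrite (left_actM lact) actK.
by exists (h * g)%g => //; rewrite (left_actM lact).
Qed.

End action_lemmas.

Section approximation.
Local Open Scope classical_set_scope.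
Local Open Scope ring_scope.
Context {R : realType} {H : topologicalGroupType} (d : H -> H -> R).
Hypotheses (cd : compatible_metric d)
  (dinv : forall g h x y : H, d (g * x * h)%g (g * y * h)%g = d x y).
Context (S : set H).
Hypotheses (countS : countable S) (denseS : dense S) (S1 : S 1%g)
  (SM : forall g h, S g -> S h -> S (g * h)%g) (SV : forall g, S g -> S g^-1%g).
Context {Y : topologicalType} (act : H -> Y -> Y).
Hypotheses (lact : left_action act)
  (cact : continuous (fun p : H * Y => act p.1 p.2)).
Implicit Types (BB : set (set Y)) (y z : Y).

Definition orbit_open (B : set Y) := forall y, open [set h | B (act h y)].

(** Membership of [z] in a closure of [{w y : d 1 w < e}], with all translations
    taken in the countable group [S] so that the relation is Borel. *)
Definition approx BB e y z := forall B k, BB B -> S k -> B (act k z) ->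
  exists w, [/\ S w, d 1%g w < e & B (act k (act w y))].

Definition asymptotic BB y z := forall e, 0 < e ->
  exists h, [/\ S h, approx BB e (act h y) z & approx BB e z (act h y)].

Lemma approx_sub BB BB' e e' y z : BB `<=` BB' -> e' <= e ->
  approx BB' e' y z -> approx BB e y z.
Proof.
move=> sBB ee' ap B k /sBB BB'B Sk /(ap _ _ BB'B Sk)[w [Sw w_e Bw]].
by exists w; split=> //; exact: lt_le_trans ee'.
Qed.

Lemma approx_trans BB e e' x y z :
  approx BB e x y -> approx BB e' y z -> approx BB (e + e') x z.
Proof.
move=> xy yz B k BBB Sk /(yz _ _ BBB Sk)[w [Sw we]].
rewrite -(left_actM lact) => /(xy _ _ BBB (SM Sk Sw))[v [Sv ve Bv]].
exists (w * v)%g; split; first exact: SM.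
  by apply: le_lt_trans (tsi_lenM cd dinv _ _) _; lra.
by rewrite -(left_actM lact) mulgA (left_actM lact).
Qed.

(** The correction [w] becomes its conjugate [h * w * h^-1], which has the same
    length: this is where the invariance of the metric on both sides matters. *)
Lemma approxJ BB e h y z : S h -> approx BB e y z ->
  approx BB e (act h y) (act h z).
Proof.
move=> Sh yz B k BBB Sk; rewrite -(left_actM lact).
move=> /(yz _ _ BBB (SM Sk Sh))[w [Sw we Bw]].
exists (h * w * h^-1)%g; split; first by apply: SM; [exact: SM|exact: SV].
  by rewrite (tsi_lenJ dinv).
rewrite -[X in act k X](left_actM lact) mulgVK.
by move: Bw; rewrite -!(left_actM lact) !mulgA.
Qed.

(** Openness of the sets of [BB] along orbits allows [w] to be replaced by a nearby
    element of [S]. *)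
Lemma approx_act BB e w y : BB `<=` orbit_open -> d 1%g w < e ->
  approx BB e y (act w y).
Proof.
move=> oBB we B k BBB Sk Bw.
have oO : open ([set h | B (act k (act h y))] `&` [set h | d 1%g h < e]).
  apply: openI; last exact: metric_open.
  rewrite (_ : [set h | _] = (fun h => k * h)%g @^-1` [set h | B (act h y)]).
    move/continuousP: (@continuous_mulgl H k); apply; exact: oBB.
  by apply/seteqP; split=> h /=; rewrite (left_actM lact).
have [|h [[Bh he] Sh]] := denseS _ oO; first by exists w.
by exists h; split.
Qed.

Lemma approx_perturb BB e h y : BB `<=` orbit_open -> 0 < e -> exists k,
  [/\ S k, approx BB e (act h y) (act k y) & approx BB e (act k y) (act h y)].
Proof.
move=> oBB e0.
have [|k [/= hk Sk]] := denseS _ (metric_open cd h e).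
  by exists h; rewrite /= (metricxx cd).
exists k; split => //.
- rewrite -[k](mulgVK h) (left_actM lact); apply: approx_act => //.
  by rewrite (tsi_len_div dinv).
- rewrite -[h in X in approx _ _ _ X](mulgVK k) (left_actM lact).
  by apply: approx_act => //; rewrite (tsi_len_div dinv) (cmetric_sym cd).
Qed.

Lemma asymptotic_trans BB x y z :
  asymptotic BB x y -> asymptotic BB y z -> asymptotic BB x z.
Proof.
move=> xy yz e e0; have e20 : 0 < e / 2 by lra.
have [h [Sh hxy yhx]] := xy _ e20; have [k [Sk kyz zky]] := yz _ e20.
exists (k * h)%g; rewrite (left_actM lact) (splitr e); split; first exact: SM.
  by apply: approx_trans kyz; exact: approxJ.
by apply: approx_trans zky _; exact: approxJ.
Qed.

Lemma asymptotic_refl BB y : BB `<=` orbit_open -> asymptotic BB y y.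
Proof.
move=> oBB e e0; have yy : approx BB e y (act 1%g y).
  by apply: approx_act => //; rewrite (metricxx cd).
by exists 1%g; split=> //; move: yy; rewrite (left_act1 lact).
Qed.

(** Elements of [H] that are not in [S] can be moved into [S], at an arbitrarily
    small cost. *)
Lemma asymptotic_orbit BB y z : BB `<=` orbit_open ->
  (forall e, 0 < e -> exists h k, approx BB e (act h y) (act k z) /\
     approx BB e (act k z) (act h y)) -> asymptotic BB y z.
Proof.
move=> oBB yz e e0; have e30 : 0 < e / 3 by lra.
have [h [k [hk kh]]] := yz _ e30.
have [h' [Sh hh' h'h]] := approx_perturb h y oBB e30.
have [k' [Sk kk' k'k]] := approx_perturb k z oBB e30.
exists (k'^-1 * h')%g; split; first by apply: SM => //; exact: SV.
  have := approxJ (SV Sk) (approx_trans h'h (approx_trans hk kk')).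
  rewrite (actK lact) -(left_actM lact); apply: approx_sub => //; lra.
have := approxJ (SV Sk) (approx_trans k'k (approx_trans kh hh')).
rewrite (actK lact) -(left_actM lact); apply: approx_sub => //; lra.
Qed.

Lemma borel_approx BB e (Z : topologicalType) (F F' : Z -> Y) :
  countable BB -> BB `<=` @borel_set Y -> borel_map F -> borel_map F' ->
  borel_set [set p | approx BB e (F p) (F' p)].
Proof.
move=> cBB bBB bF bF'.
have bact k B : BB B -> borel_set (act k @^-1` B).
  by move=> /bBB; apply: continuous_borel_map; exact: continuous_act cact _.
rewrite (_ : [set p | _] = [set p | forall B, BB B -> forall k, S k ->
    B (act k (F' p)) -> exists2 w, S w /\ d 1%g w < e &
      B (act k (act w (F p)))]).
  apply: borel_forall => // B BBB; apply: borel_forall => // k Sk.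
  apply: borel_imply; first exact: (bF' _ (bact k B BBB)).
  apply: borel_exists => [|w _].
    by apply: sub_countable countS; apply: subset_card_le => w [].
  rewrite (_ : [set p | _] = F @^-1` (act (k * w)%g @^-1` B)).
    exact: (bF _ (bact _ _ BBB)).
  by apply/seteqP; split=> p /=; rewrite (left_actM lact).
apply/seteqP; split=> p pP.
  by move=> B BBB k Sk /(pP _ _ BBB Sk)[w [? ? ?]]; exists w.
by move=> B k BBB Sk /(pP _ BBB _ Sk)[w [? ?] ?]; exists w.
Qed.

End approximation.

(** * Unbalanced points have asymptotic images *)

Section orbit_category.
Local Open Scope classical_set_scope.
Context {G : topologicalGroupType} {X : topologicalType} {act : G -> X -> X}.
Hypotheses (lact : left_action act)
  (cact : continuous (fun p : G * X => act p.1 p.2)).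

(** The points whose orbit is generically in [A]; unlike [A], this set is
    invariant. *)
Definition orbitwise (A : set X) := [set x | comeager [set g | A (act g x)]].

Lemma orbitwise_invariant A : ginvariant act (orbitwise A).
Proof.
move=> h x /(comeager_mulgr h); apply: comeager_sub => g /=.
by rewrite (left_actM lact).
Qed.

Lemma continuous_act_swap : continuous (fun p : X * G => act p.2 p.1).
Proof.
move=> p; apply: (@continuous_comp _ _ _ (fun p : X * G => (p.2, p.1))
  (fun p : G * X => act p.1 p.2)); last exact: cact.
by apply: cvg_pair => /=; [exact: cvg_snd|exact: cvg_fst].
Qed.

Lemma orbitwise_comeager A : @second_countable G ->
  comeager A -> comeager (orbitwise A).
Proof.
move=> scG cA; apply: (kuratowski_ulam scG (A := [set p | A (act p.2 p.1)])).
apply: (comeager_preimage (f := fun p : X * G => act p.2 p.1)) cA.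
  exact: continuous_act_swap.
move=> U oU dU O [[x g] Oxg] oO.
have /prod_nbhsP[P [Q [oP Px oQ Qg PQ]]] : nbhs (x, g) O.
  exact: open_nbhs_nbhs.
have [||y [/= Py Uy]] := dU [set y | P (act g^-1%g y)].
- by exists (act g x); rewrite /= (actK lact).
- by move/continuousP: (@continuous_act _ _ _ cact g^-1%g); apply.
- exists (act g^-1%g y, g); split; first by apply: PQ.
  by rewrite /= (actKV lact).
Qed.

End orbit_category.

Section preservation.
Local Open Scope classical_set_scope.
Local Open Scope ring_scope.
Context {R : realType} {H : topologicalGroupType} (d : H -> H -> R).
Hypotheses (cd : compatible_metric d)
  (dinv : forall g h x y : H, d (g * x * h)%g (g * y * h)%g = d x y).
Context (S : set H).
Hypotheses (countS : countable S) (denseS : dense S)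
  (SM : forall g h, S g -> S h -> S (g * h)%g) (SV : forall g, S g -> S g^-1%g).
Context {Y : topologicalType} (actY : H -> Y -> Y).
Hypotheses (lactY : left_action actY)
  (cactY : continuous (fun p : H * Y => actY p.1 p.2)).
Context {G : topologicalGroupType} {X : topologicalType} (act : G -> X -> X).
Hypotheses (lact : left_action act)
  (cact : continuous (fun p : G * X => act p.1 p.2))
  (scG : @second_countable G) (bG : baire_space G).
Context (f : X -> Y).
Hypotheses (bf : borel_map f)
  (homf : forall x x', orbit_eqrel act x x' -> orbit_eqrel actY (f x) (f x')).
Context (BB : set (set Y)).
Hypotheses (cBB : countable BB) (bBB : BB `<=` @borel_set Y)
  (oBB : BB `<=` orbit_open actY).

Let homfP g x : exists h, f (act g x) = actY h (f x).
Proof.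
by apply/(orbit_eqrelP lactY); apply: homf; apply/(orbit_eqrelP lact); exists g.
Qed.

(** By the Baire property, [f] pulls back the [S]-translates of sets of [BB] to
    open sets [O], on a comeager set [C0].  Moreover [X * G] is the union
    over [h] in [S] of the Borel sets [A n h] of the [(x, g)] such that [f (g x)]
    and [h (f x)] approximate each other; each of them is open up to a meager
    set, so the orbit of a generic [x] meets an open [P] such that, for some
    fixed [h] and open [Q], [f (v c)] is close to [h (f c)] for generic [c] in [P]
    and generic [v] in [Q].  Applying unbalancedness to a translate of [P] yields
    [a] and [b] in the two orbits with [b] in the closure of [V a].  After small
    generic translations of [a] and [b], the point [f (v b)] is approximated by
    points [f (v' a)] with [v] and [v'] in [Q]; all of these are close to [h (f a)], and [f (v b)] is close to
    [h (f b)].  Cancelling [h] concludes. *)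
Lemma unbalanced_asymptotic : exists C, [/\ comeager C, ginvariant act C &
  forall x y, C x -> C y -> unbalanced_rel act x y ->
    asymptotic d S actY BB (f x) (f y)].
Proof.
have /choice[O OP] : forall Bk : set Y * H, exists O : set X,
    BB Bk.1 -> open O /\ comeager [set x | Bk.1 (actY Bk.2 (f x)) <-> O x].
  move=> [B k] /=; have [BBB|] := pselect (BB B); last by exists set0.
  have [|O oO cO] := @borel_baire_property _ [set x | B (actY k (f x))].
    apply: (bf (B := actY k @^-1` B)).
    by apply: continuous_borel_map; [exact: continuous_act cactY _|exact: bBB].
  by exists O.
pose C0 := [set x | forall B, BB B -> forall k, S k ->
  (B (actY k (f x)) <-> O (B, k) x)].
have cC0 : comeager C0.
  apply: comeager_forall => // B BBB; apply: comeager_forall => // k Sk.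
  exact: (OP (B, k) BBB).2.
pose A n h := [set p : X * G |
  approx d S actY BB (eps n) (actY h (f p.1)) (f (act p.2 p.1)) /\
  approx d S actY BB (eps n) (f (act p.2 p.1)) (actY h (f p.1))].
have bpA nh : exists T, open T /\ comeager [set p | A nh.1 nh.2 p <-> T p].
  have b1 : borel_map (fun p : X * G => actY nh.2 (f p.1)).
    apply: (borel_map_comp (g := actY nh.2) (f := fun p : X * G => f p.1)).
      apply: (borel_map_comp (g := f) (f := @fst X G)) => //.
      by apply: continuous_borel_map => p; exact: cvg_fst.
    by apply: continuous_borel_map; exact: continuous_act cactY _.
  have b2 : borel_map (fun p : X * G => f (act p.2 p.1)).
    apply: (borel_map_comp (g := f)) => //.
    by apply: continuous_borel_map; exact: continuous_act_swap cact.
  have [|T oT cT] := @borel_baire_property _ (A nh.1 nh.2); last by exists T.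
  by apply: borel_setI; exact: (borel_approx _ countS lactY cactY _ cBB bBB).
have {bpA}/choice[T TP] := bpA.
pose C2 := [set x | comeager [set g | forall n, [set: nat] n ->
  forall h, S h -> (A n h (x, g) <-> T (n, h) (x, g))]].
have cC2 : comeager C2.
  apply: (kuratowski_ulam scG (A := [set p | forall n, [set: nat] n ->
    forall h, S h -> (A n h p <-> T (n, h) p)])).
  apply: comeager_forall => // n _; apply: comeager_forall => // h Sh.
  exact: (TP (n, h)).2.
pose C := orbitwise (act := act) (C0 `&` C2).
have invC : ginvariant act C by exact: orbitwise_invariant lact _.
exists C; split=> // [|x y Cx Cy xy].
  by apply: orbitwise_comeager => //; exact: comeagerI.
apply: (asymptotic_orbit cd) => // e e0.
have [n ne] := eps_lt e0.
have cont_act c g : open g -> open [set k | g (act k c)].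
  by move/continuousP: (@continuous_orbit _ _ _ cact c); apply.
(* A rectangle [P] x [Q] on which [A n.+1 h] is comeager, with [P] meeting the
   orbit of [x]. *)
have [g0 _ [_ C2z]] := baire_point (x := 1%g) bG Cx openT Logic.I.
set z := act g0 x in C2z.
have [g _ Ag] := baire_point (x := 1%g) bG C2z openT Logic.I.
have [k fgz] := homfP g z.
have [h [Sh kh hk]] := approx_perturb cd dinv denseS lactY k (f z) oBB (eps_gt0 n.+1).
have /prod_nbhsP[P [Q [oP Pz oQ Qg PQ]]] : nbhs (z, g) (T (n.+1, h)).
  apply: open_nbhs_nbhs; split; first exact: (TP _).1.
  by apply/Ag => //; rewrite /A/= fgz.
(* [V] leaves room for the perturbations [u] and [v] of [1] and [g] below. *)
have [V [oV V1 VQ]] : exists V : set G, [/\ open V, V 1%g &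
    forall p q r, V p -> V q -> V r -> Q (p * q * g * r^-1)%g].
  pose F (t : G * G * G) := (t.1.1 * t.1.2 * g * t.2^-1)%g.
  have cF : continuous F.
    move=> t; apply: (@continuous_comp _ _ _
      (fun t : G * G * G => ((t.1.1 * t.1.2 * g)%g, t.2^-1)%g)
      (fun p => p.1 * p.2)%g); last exact: mulg_continuous.
    apply: cvg_pair => /=.
      apply: (@continuous_comp _ _ _ (fun t : G * G * G => t.1.1 * t.1.2)%g
        (fun x => x * g)%g); last exact: continuous_mulgr.
      apply: (@continuous_comp _ _ _ (fun t : G * G * G => t.1)
        (fun p => p.1 * p.2)%g); last exact: mulg_continuous.
      exact: cvg_fst.
    apply: (@continuous_comp _ _ _ (fun t : G * G * G => t.2)
      (fun x => x^-1)%g); last exact: invg_continuous.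
    exact: cvg_snd.
  have : nbhs (1%g, 1%g, 1%g) (F @^-1` Q).
    apply: cF; apply: open_nbhs_nbhs; split=> //.
    by rewrite /F/= invg1 !mul1g mulg1.
  move=> /prod_nbhsP[P1 [V3 [oP1 P11 oV3 V31 PV3]]].
  have /prod_nbhsP[V1 [V2 [oV1 V11 oV2 V21 PV12]]] : nbhs (1%g, 1%g) P1.
    exact: open_nbhs_nbhs.
  exists (V1 `&` V2 `&` V3); split=> [||p q r [[? ?] ?] [[? ?] ?] [[? ?] ?]].
  - by do 2?apply: openI.
  - by [].
  - by apply: (PV3 (p, q, r)); split=> //; apply: PV12.
pose U := [set b | P (act g^-1%g b)].
have oU : open U.
  by move/continuousP: (@continuous_act _ _ _ cact g^-1%g); apply.
have [|gx [gy [Ua Ub baV abV]]] := xy V U oV V1 oU.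
  left; exists (act g z); split; first by rewrite /U/= (actK lact).
  by exists (g * g0)%g => //; rewrite (left_actM lact).
move: Ua Ub baV abV; set a := act gx x; set b := act gy y.
rewrite /U/=; set za := act g^-1%g a; set zb := act g^-1%g b.
move=> Pa Pb baV abV.
have Ca : C za by exact: (invC _ _ (invC _ _ Cx)).
have Cb : C zb by exact: (invC _ _ (invC _ _ Cy)).
(* [za] and [zb] need not be generic, but their translates by a generic [u] are,
   and by a [u] close to [1] they remain in [P]. *)
have [u [[Vu Pua] Pub] [[_ C2a] [_ C2b]]] : exists2 u,
    (V u /\ P (act u za)) /\ P (act u zb) &
    (C0 `&` C2) (act u za) /\ (C0 `&` C2) (act u zb).
  apply: (baire_point (x := 1%g) bG (comeagerI Ca Cb)
    (O := V `&` [set u | P (act u za)] `&` [set u | P (act u zb)])).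
  - by do 2?apply: openI => //; exact: cont_act.
  - by rewrite /= !(left_act1 lact).
have {}Ca : C (act u za) by exact: invC.
have {}Cb : C (act u zb) by exact: invC.
(* [g * u^-1] is an admissible value of [v], except for genericity. *)
have [v [Qv Vv] [[[C0a _] [C0b _]] [Aa Ab]]] : exists2 v,
    Q v /\ V (v * (u * g^-1))%g &
    ((C0 `&` C2) (act v (act u za)) /\ (C0 `&` C2) (act v (act u zb))) /\
    ((forall n, [set: nat] n -> forall h, S h ->
       (A n h (act u za, v) <-> T (n, h) (act u za, v))) /\
     (forall n, [set: nat] n -> forall h, S h ->
       (A n h (act u zb, v) <-> T (n, h) (act u zb, v)))).
  apply: (baire_point (x := (g * u^-1)%g) bG
    (comeagerI (comeagerI Ca Cb) (comeagerI C2a C2b))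
    (O := Q `&` [set v | V (v * (u * g^-1))%g])).
  - apply: openI => //.
    by move/continuousP: (@continuous_mulgr _ (u * g^-1)%g); apply.
  - split; first by have := VQ _ _ _ V1 V1 Vu; rewrite !mul1g.
    by rewrite /= mulgA mulgVK mulgV.
have {}Aa := (Aa n.+1 Logic.I h Sh).2 (PQ (act u za, v) (conj Pua Qv)).
have {}Ab := (Ab n.+1 Logic.I h Sh).2 (PQ (act u zb, v) (conj Pub Qv)).
have claim a' b' : let za' := act g^-1%g a' in let zb' := act g^-1%g b' in
    C (act u za') -> C2 (act u za') -> P (act u za') ->
    C0 (act v (act u zb')) -> A n.+1 h (act u zb', v) ->
    closure [set act w a' | w in V] b' ->
    approx d S actY BB (eps n) (f (act u za')) (f (act u zb')).
  move=> za' zb' Ca' C2a' Pa' C0b' Ab' cl.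
  suff ap : approx d S actY BB (eps n.+1) (actY h (f (act u za')))
      (f (act v (act u zb'))).
    have := approxJ dinv SM SV lactY (SV Sh)
      (approx_trans cd dinv SM lactY ap Ab'.2).
    by rewrite !(actK lactY) -epsS.
  move=> B l BBB Sl Bl.
  have oO : open (O (B, l)) by exact: (OP (B, l) BBB).1.
  have Ob' : O (B, l) (act v (act u zb')) by apply/C0b'.
  have [c [[w Vw <-] Oc]] : [set act w a' | w in V] `&`
      [set c | O (B, l) (act (v * (u * g^-1))%g c)] !=set0.
    apply: cl; apply: open_nbhs_nbhs; split.
      by move/continuousP: (@continuous_act _ _ _ cact (v * (u * g^-1))%g); apply.
    by rewrite /= !(left_actM lact).
  (* The non-generic value [v u g^-1 w g u^-1] of [v'] sends [u za'] to the point
     of [O] given by the closure; nearby generic values work too. *)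
  have [v' [Qv' Ov'] [[C0v' _] Av']] : exists2 v',
      Q v' /\ O (B, l) (act v' (act u za')) &
      (C0 `&` C2) (act v' (act u za')) /\
      (forall n, [set: nat] n -> forall h, S h ->
        (A n h (act u za', v') <-> T (n, h) (act u za', v'))).
    apply: (baire_point (x := (v * (u * g^-1) * w * g * u^-1)%g) bG
      (comeagerI Ca' C2a')
      (O := Q `&` [set v' | O (B, l) (act v' (act u za'))])).
    - by apply: openI => //; exact: cont_act.
    - split; first exact: VQ.
      move: Oc; rewrite /= !(left_actM lact) (actK lact u).
      by rewrite /za' (actKV lact).
  have {}Av' := (Av' n.+1 Logic.I h Sh).2 (PQ (act u za', v') (conj Pa' Qv')).
  by apply: (Av'.1) => //; apply/C0v'.
have [hx fx] := homfP (u * g^-1 * gx)%g x.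
have [hy fy] := homfP (u * g^-1 * gy)%g y.
exists hx, hy; rewrite -fx -fy !(left_actM lact).
by split; (apply: (approx_sub (BB' := BB) (e' := eps n)) => //; first exact: ltW);
  apply: claim.
Qed.

End preservation.

(** * Stabilization and limits *)

Section stabilization.
Local Open Scope classical_set_scope.
Context {Z : topologicalType} {T I : Type} (D : set T) (J : set I)
  (A : set T -> I -> set Z).
Hypotheses (scZ : @second_countable Z) (bZ : baire_space Z)
  (countJ : countable J)
  (antiA : forall BB BB' i, BB `<=` BB' -> A BB' i `<=` A BB i)
  (borelA : forall BB i, countable BB -> BB `<=` D -> borel_set (A BB i)).

(** [A BB i] decreases when [BB] grows.  For each of the countably many pairs of an
    index [i] and a basic open set [O] such that some countable family makes
    [A _ i] meager in [O], put such a family into [BB0].  If a larger [BB1] made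
    [A _ i] lose a nonmeager set, this set would be comeager in some basic [O]
    in which [A BB1 i], hence already [A BB0 i], is meager, which is absurd. *)
Lemma stable_stage BB : countable BB -> BB `<=` D ->
  exists BB0, [/\ countable BB0, BB0 `<=` D, BB `<=` BB0 &
    forall BB1, countable BB1 -> BB1 `<=` D -> BB0 `<=` BB1 ->
      forall i, J i -> comeager [set z | A BB0 i z -> A BB1 i z]].
Proof.
move=> cBB BBD; have [W cW [oW WP]] := scZ.
have /choice[K KP] : forall iO : I * set Z, exists K : set T,
    [/\ countable K, K `<=` D &
      forall BB1, countable BB1 -> BB1 `<=` D ->
        meager (iO.2 `&` A BB1 iO.1) -> meager (iO.2 `&` A K iO.1)].
  move=> [i O] /=; have [[K [cK KD mK]]|nK] := pselect (exists K,
      [/\ countable K, K `<=` D & meager (O `&` A K i)]).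
    by exists K.
  exists set0; split=> // BB1 cBB1 BB1D mBB1.
  by case: nK; exists BB1.
pose BB0 := BB `|` \bigcup_(iO in J `*` W) K iO.
have cBB0 : countable BB0.
  rewrite /BB0 -bigcup2E; apply: bigcup_countable => // -[|[|n]] _ //=.
  apply: bigcup_countable => [|iO _]; first exact: countableX.
  by have [] := KP iO.
have BB0D : BB0 `<=` D.
  by move=> B [/BBD//|[iO _]]; have [_ KD _] := KP iO; exact: KD.
exists BB0; split=> //; first by move=> B BBB; left.
move=> BB1 cBB1 BB1D BB01 i Ji.
have bE : borel_set (A BB0 i `&` ~` A BB1 i).
  by apply: borel_setI; [exact: borelA|apply: borel_setC; exact: borelA].
have [U oU cU] := borel_baire_property bE.
have [U0|/set0P[z Uz]] := eqVneq U set0.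
  apply: comeager_sub cU => z /= EU A0z; apply: contrapT => nA1z.
  by have := EU.1 (conj A0z nA1z); rewrite U0.
have [O [WO Oz] OU] : filter_from [set O | W O /\ O z] id U.
  by apply: WP; exact: open_nbhs_nbhs.
have [_ _ /(_ BB1 cBB1 BB1D)] := KP (i, O); case.
  by apply: meager_sub cU => z' /= [/OU Uz' A1z'] [_ /(_ Uz')[]].
move=> F nF FO; have cO : comeager (~` (O `&` A (K (i, O)) i)).
  by rewrite /comeager setCK; exists F.
have [z' Oz' [EU nK]] := baire_point bZ (comeagerI cU cO) (oW _ WO) Oz.
have [A0z' _] := EU.2 (OU _ Oz').
case: nK; split=> //; apply: antiA A0z' => B KB; right; exists (i, O) => //.
Qed.

End stabilization.

Section approximation_limit.
Local Open Scope classical_set_scope.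
Local Open Scope ring_scope.
Context {R : realType} {H : topologicalGroupType} (d : H -> H -> R).
Hypotheses (cd : compatible_metric d) (cmd : complete_metric d)
  (dinv : forall g h x y : H, d (g * x * h)%g (g * y * h)%g = d x y).
Context (S : set H) (S1 : S 1%g).
Context {Y : topologicalType} (act : H -> Y -> Y) (dY : Y -> Y -> R).
Hypotheses (lact : left_action act)
  (cact : continuous (fun p : H * Y => act p.1 p.2))
  (cdY : compatible_metric dY).

Lemma geometric_cauchy (u : nat -> H) :
  (forall n, d (u n) (u n.+1) < eps n) -> exists l : H, u @ \oo --> l.
Proof.
move=> du; have un n k : d (u n) (u (k + n)%N) <= 2 * eps n - 2 * eps (k + n)%N.
  have := eps_gt0 (R := R) n.
  elim: k => [|k IH] en; first by rewrite add0n (metricxx cd); lra.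
  apply: le_trans (cmetric_triangle cd (u (k + n)%N) _ _) _.
  have := IH en; have := du (k + n)%N; have := epsS (R := R) (k + n); lra.
apply: cmd => e e0; have [N Ne] := eps_lt e0.
exists N.+2 => m n /subnK <- /subnK <-.
have := cmetric_triangle cd (u N.+2) (u (m - N.+2 + N.+2)%N) (u (n - N.+2 + N.+2)%N).
rewrite (cmetric_sym cd (u (m - N.+2 + N.+2)%N) (u N.+2)).
have := un N.+2 (m - N.+2)%N; have := un N.+2 (n - N.+2)%N.
have := eps_gt0 (R := R) (m - N.+2 + N.+2); have := eps_gt0 (R := R) (n - N.+2 + N.+2).
have := epsS (R := R) N; have := epsS (R := R) N.+1; lra.
Qed.

(** Since [BB] contains a basis [W], [z] is in the closure of
    [{w (u n y) : |w| < eps n}] for the topology of [Y], and these sets shrink to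
    the image of [y] under the limit of [u]. *)
Lemma approx_limit (BB W : set (set Y)) (u : nat -> H) y z :
  basis W -> W `<=` BB -> (forall n, d (u n) (u n.+1) < eps n) ->
  (forall n, approx d S act BB (eps n) (act (u n) y) z) ->
  exists l, z = act l y.
Proof.
move=> [_ WP] WB du uz; have [l ul] := geometric_cauchy du.
exists l; apply/esym/(cmetric_eq0 cdY); apply: contrapT => /eqP ne.
have e0 : 0 < dY (act l y) z / 2.
  by rewrite divr_gt0// lt_neqAle eq_sym ne/=; exact: metric_ge0.
set e := _ / 2 in e0.
have oO : open (act^~ y @^-1` [set t | dY (act l y) t < e]).
  have /continuousP := @continuous_orbit _ _ _ cact y.
  by apply; exact: (metric_open cdY).
have [|r r0 rP] := metric_openP cd (x := l) oO.
  by rewrite /= (metricxx cdY).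
have [B [WBB Bz] Be] : filter_from [set B | W B /\ B z] id [set t | dY z t < e].
  by apply: WP; exact: metric_nbhs.
have r20 : 0 < r / 2 by lra.
have [N NP] := (metric_cvgP cd _ _).1 ul _ r20.
have [M Mr] := eps_lt r20; pose n := maxn N M.
have [|w [Sw wn]] := uz n B 1%g (WB _ WBB) S1; first by rewrite (left_act1 lact).
rewrite (left_act1 lact) -(left_actM lact) => Bw.
have /= := Be _ Bw.
have /rP/= : d l (w * u n)%g < r.
  apply: le_lt_trans (cmetric_triangle cd (u n) _ _) _.
  rewrite -{2}(mul1g (u n)) (tsi_mulgr dinv).
  have := NP n (leq_maxl _ _); have := eps_le (R := R) (leq_maxr N M).
  by rewrite -/n; lra.
have := cmetric_triangle cdY (act (w * u n)%g y) (act l y) z.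
by rewrite (cmetric_sym cdY (act (w * u n)%g y) z) /e; lra.
Qed.

End approximation_limit.

(** * Non-classifiability *)

Section collapse.
Local Open Scope classical_set_scope.
Local Open Scope ring_scope.
Context {R : realType} {H : topologicalGroupType} {Y : topologicalType}
  (actY : H -> Y -> Y) {G : topologicalGroupType} {X : topologicalType}
  (act : G -> X -> X).
Hypotheses (polishG : polish R G) (polishX : polish_gspace R act)
  (X_nonempty : exists x : X, True) (semiX : generically_semi_connected act)
  (polishH : polish R H) (tsiH : tsi R H) (polishY : polish_gspace R actY).
Context (f : X -> Y).
Hypotheses (bf : borel_map f)
  (homf : forall x x', orbit_eqrel act x x' -> orbit_eqrel actY (f x) (f x')).

(** The argument is by contradiction: for a generic pair [(x, x')] it produces an
    element of [H] taking [f x] to [f x']. *)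
Lemma nonmeager_orbit_preimage :
  exists x, ~ meager [set x' | orbit_eqrel actY (f x) (f x')].
Proof.
have [d cd dinv] := tsiH; have cmd := tsi_complete cd dinv polishH.
have [sH _] := polishH; have [S [cS dS S1 SM SV]] := countable_dense_subgroup sH.
have [pX lact cact] := polishX; have [pY lactY cactY] := polishY.
have bX := polish_baire pX; have scX := polish_second_countable pX.
have bG := polish_baire polishG; have scG := polish_second_countable polishG.
have [_ [dY cdY _]] := pY; have [W cW bW] := polish_second_countable pY.
pose adm := [set B : set Y | borel_set B /\ orbit_open actY B].
pose approxY := approx d S actY; pose asymY := asymptotic d S actY.
(* [asymY BB] being transitive, paths in [C] map into one class. *)
have generic_asym (BB : set (set Y)) : countable BB -> BB `<=` adm ->
    exists2 D, comeager D & forall x y, D x -> D y -> asymY BB (f x) (f y).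
  move=> cBB admBB; have oBB : BB `<=` orbit_open actY by move=> B /admBB[].
  have bBB : BB `<=` @borel_set Y by move=> B /admBB[].
  have [C [cC invC CP]] := unbalanced_asymptotic cd dinv cS dS SM SV lactY
    cactY lact cact scG bG bf homf cBB bBB oBB.
  have [D [cD _ DP]] := semiX invC cC.
  exists D => // x y Dx Dy; have [n [s [<- <- sC su]]] := DP x y Dx Dy.
  elim: n sC su => [|n IH] sC su.
    exact: (asymptotic_refl cd).
  apply: (asymptotic_trans cd dinv SM SV lactY (y := f (s n))).
    by apply: IH => i ni; [apply: sC|apply: su]; exact: ltnW.
  by apply: CP; [exact: sC|exact: sC|exact: su].
pose A BB (i : nat * H) :=
  [set p : X * X | approxY BB (eps i.1) (actY i.2 (f p.1)) (f p.2)].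
have antiA BB BB' i : BB `<=` BB' -> A BB' i `<=` A BB i.
  by move=> sBB p; apply: approx_sub.
have borelA BB i : countable BB -> BB `<=` adm -> borel_set (A BB i).
  move=> cBB admBB; apply: borel_approx => //.
  - by move=> B /admBB[].
  - apply: (borel_map_comp (g := actY i.2) (f := fun p : X * X => f p.1)).
      apply: (borel_map_comp (g := f) (f := @fst X X)) => //.
      by apply: continuous_borel_map => p; exact: cvg_fst.
    by apply: continuous_borel_map; exact: continuous_act cactY _.
  - apply: (borel_map_comp (g := f) (f := @snd X X)) => //.
    by apply: continuous_borel_map => p; exact: cvg_snd.
have scXX := second_countable_prod scX scX.
have admW : W `<=` adm.
  move=> B /bW.1 oB; split; first exact: borel_open.
  by move=> y; move/continuousP: (@continuous_orbit _ _ _ cactY y); apply.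
have cJ : countable ([set: nat] `*` S) by exact: countableX.
have [BB0 [cBB0 admBB0 WBB0 stable0]] :=
  stable_stage scXX (baire_prod scX bX bX) cJ antiA borelA cW admW.
have oBB0 : BB0 `<=` orbit_open actY by move=> B /admBB0[].
have [D0 cD0 D0P] := generic_asym _ cBB0 admBB0.
have [xx _] := X_nonempty.
have [x0 _ D0x0] := baire_point (x := xx) bX cD0 openT Logic.I.
(* The union over [j] makes these sets open along orbits: small translations
   are absorbed by passing to a larger [j]. *)
pose near_x0 (i : nat * H) := [set z | exists j,
  approxY BB0 (eps i.1 - eps j) z (actY i.2 (f x0))].
pose BB1 := BB0 `|` near_x0 @` ([set: nat] `*` S).
have cBB1 : countable BB1.
  rewrite /BB1 -bigcup2E; apply: bigcup_countable => // -[|[|n]] _ //=.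
  exact: card_le_trans (card_image_le _ _) cJ.
have admBB1 : BB1 `<=` adm.
  move=> B [/admBB0//|[i _ <-]]; split.
    rewrite (_ : near_x0 i = [set z | exists2 j, [set: nat] j &
      approxY BB0 (eps i.1 - eps j) z (actY i.2 (f x0))]); last first.
      by apply/seteqP; split=> z [j]; [exists j|exists j].
    apply: borel_exists => // j _.
    apply: (borel_approx _ cS lactY cactY _ (F := id) (F' := fun=> actY i.2 (f x0))) => //.
    - by move=> B' /admBB0[].
    - by apply: continuous_borel_map => z; exact: cvg_cst.
  move=> y; rewrite openE => g [j gj]; apply/(cmetric_nbhs cd).
  exists (eps j.+1); first exact: eps_gt0.
  move=> g' /= gg'; exists j.+1.
  rewrite (_ : eps i.1 - eps j.+1 = eps j.+1 + (eps i.1 - eps j)); last first.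
    by rewrite (epsS j); lra.
  apply: (approx_trans cd dinv SM lactY _ gj).
  have -> : actY g y = actY (g * g'^-1)%g (actY g' y).
    by rewrite -(left_actM lactY) mulgVK.
  apply: (approx_act cd dS) => //.
  by rewrite (tsi_len_div dinv) (cmetric_sym cd).
have [D1 cD1 D1P] := generic_asym _ cBB1 admBB1.
have cst : comeager [set p | forall i, ([set: nat] `*` S) i ->
    A BB0 i p -> A BB1 i p].
  by apply: comeager_forall => // i Ji; apply: stable0 => // B; left.
have [x _ [D1x stx]] := baire_point (x := xx) bX
  (comeagerI cD1 (kuratowski_ulam scX cst)) openT Logic.I.
exists x => mx.
have cx : comeager (~` [set x' | orbit_eqrel actY (f x) (f x')]).
  by rewrite /comeager setCK.
have [x' _ [[D0x' D1x'] [stxx' nE]]] := baire_point (x := xx) bX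
  (comeagerI (comeagerI cD0 cD1) (comeagerI stx cx)) openT Logic.I.
apply: nE; apply/(orbit_eqrelP lactY).
pose P n h := S h /\ approxY BB1 (eps n) (actY h (f x)) (f x').
(* The set [near_x0 (n.+2, h1)] contains [f x'] and consists of points within
   [eps n.+2] of [h1 (f x0)], which is itself within [eps n.+3] of [f x']. *)
have step n h : P n h -> exists2 w, d 1%g w < eps n & P n.+1 (w * h)%g.
  move=> [Sh hx].
  have [h1 [Sh1 h1x' x'h1]] := D0P x0 x' D0x0 D0x' _ (eps_gt0 n.+3).
  have BBh1 : BB1 (near_x0 (n.+2, h1)) by right; exists (n.+2, h1).
  have [|w [Sw wn]] := hx _ 1%g BBh1 S1.
    exists n.+3 => /=; rewrite (left_act1 lactY) (epsS n.+2).
    by rewrite addrK.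
  rewrite (left_act1 lactY) -(left_actM lactY) => -[j /= wj].
  exists w => //; split; first exact: SM.
  apply: (stxx' (n.+1, (w * h)%g)); first by split=> //; exact: SM.
  apply: approx_sub (approx_trans cd dinv SM lactY wj h1x') => //.
  have := eps_gt0 (R := R) j; have := epsS (R := R) n.+1.
  have := epsS (R := R) n.+2; have := eps_gt0 (R := R) n.+3; rewrite /=; lra.
have [h [Sh hx _]] := D1P x x' D1x D1x' _ (eps_gt0 0).
pose next (q q' : {q : nat * H | P q.1 q.2}) :=
  (sval q').1 = (sval q).1.+1 /\ d (sval q).2 (sval q').2 < eps (sval q).1.
have nextP q : {q' | next q q'}.
  move: q => [[n k] Pnk]; apply: cid; have [w wn Pw] := step n k Pnk.
  exists (exist _ (n.+1, (w * k)%g) Pw); split=> //=.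
  by rewrite -{1}(mul1g k) (tsi_mulgr dinv).
have [q [q0 qS]] := dependent_choice nextP
  (exist (fun q : nat * H => P q.1 q.2) (0%N, h) (conj Sh hx)).
have qn n : (sval (q n)).1 = n.
  by elim: n => [|n IH]; [rewrite q0|have [-> _] := qS n; rewrite IH].
apply: (approx_limit cd cmd dinv S1 lactY cactY cdY (BB := BB1) bW
  (u := fun n => (sval (q n)).2)).
- by move=> B /WBB0; left.
- by move=> n; have [_] := qS n; rewrite qn.
- by move=> n; have := svalP (q n); rewrite qn => -[].
Qed.

End collapse.

Theorem corollary1p4 (R : realType) (G : topologicalGroupType)
    (X : topologicalType) (act : G -> X -> X)
    (polishG : polish R G) (polishX : polish_gspace R act)
    (X_nonempty : exists x : X, True)
    (unbalX : generically_unbalanced act) :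
  ~ classifiable_by_tsi_actions R (orbit_eqrel act).
Proof.
move=> [H [Y [actY [f [pH tH pY bf fE]]]]].
have [meagerX semiX] := unbalX; have [pX lact cact] := polishX.
have [|x ncx] := nonmeager_orbit_preimage polishG polishX X_nonempty semiX pH tH pY bf.
  by move=> x x' /fE.
apply: ncx; apply: meager_sub (meagerX x) => x' /fE.
by move=> /(orbit_eqrelP lact)[g ->]; exists g.
Qed.
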